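(* For every prime power $q$ and every even integer $m\ge 2$, $$\rho(1,m)=(q-1)q^{m-1}-q^{\frac{m}{2}-1}.$$
   Context: Let $q$ be a prime power and $\mathbb{F}_q$ the field with $q$ elements. $B_m^q=\mathbb{F}_q[X_1,\ldots,X_m]/(X_1^q-X_1,\ldots,X_m^q-X_m)$ is identified with the set of all functions $\mathbb{F}_q^m\to\mathbb{F}_q$. The degree $\deg(P)$ of $P\in B_m^q$ is the degree of its unique polynomial representative of degree at most $q-1$ in each variable. The weight of $P\in B_m^q$ is $|P|=\mathrm{Card}\{x\in\mathbb{F}_q^m : P(x)\neq 0\}$. The first order generalized Reed-Muller code is $R_q(1,m)=\{P\in B_m^q : \deg(P)\leq 1\}$. Its covering radius is $$\rho(1,m)=\max_{f\in B_m^q}\ \min_{c\in R_q(1,m)}|f-c|.$$ *)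

(* Defs.v *)
From HB Require Import structures.
From mathcomp Require Import all_boot all_order all_algebra all_field.
From mathcomp Require Import mpoly.

Set Implicit Arguments.
Unset Strict Implicit.
Unset Printing Implicit Defensive.

Import GRing.Theory.

Local Open Scope ring_scope.

(* The algebra F_q[X_1, .., X_m] / (X_i^q - X_i), as the functions F^m -> F. *)
Notation Bq F m := {ffun 'rV[F]_m -> F}.

Definition reduced (F : finFieldType) (m : nat) (p : {mpoly F[m]}) : bool :=
  all (fun e : 'X_{1..m} => [forall i, (e i <= #|F|.-1)%N]) (msupp p).

Definition represents (F : finFieldType) (m : nat) (p : {mpoly F[m]})
    (f : Bq F m) : bool :=
  [forall x : 'rV[F]_m, p.@[x 0] == f x].

Section ReducedForm.
Variables (F : finFieldType) (m : nat).
Local Notation q := #|F|.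
Local Notation expo := {ffun 'I_m -> 'I_q}.
Implicit Types (f : Bq F m) (c : {ffun expo -> F}) (p : {mpoly F[m]}).

Let mon (e : expo) : 'X_{1..m} := [multinom (e i : nat) | i < m].
Let poly_of c : {mpoly F[m]} := \sum_e c e *: 'X_[mon e].
Let fun_of c : Bq F m := [ffun x : 'rV[F]_m => (poly_of c).@[x 0]].

Let q_gt0 : (0 < q)%N.
Proof. by apply/card_gt0P; exists 0. Qed.

Let fun_ofE c (x : 'rV[F]_m) : fun_of c x = \sum_e c e * \prod_i x 0 i ^+ e i.
Proof.
rewrite ffunE /poly_of raddf_sum; apply: eq_bigr => e _ /=.
by rewrite mevalZ mevalX; congr (_ * _); apply: eq_bigr => i _; rewrite mnmE.
Qed.

Let reduced_poly_of c : reduced (poly_of c).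
Proof.
apply/allP => e /msupp_sum_le /flatten_mapP[d _ /msuppZ_le].
rewrite msuppX inE => /eqP ->; apply/forallP => i.
by rewrite mnmE -ltnS prednK.
Qed.

Let point_poly (a : F) : {poly F} := 1 - ('X - a%:P) ^+ q.-1.

Let size_point_poly a : (size (point_poly a) <= q)%N.
Proof.
rewrite /point_poly (leq_trans (size_polyD _ _)) // size_polyN size_exp_XsubC.
by rewrite size_poly1 prednK // geq_max q_gt0 leqnn.
Qed.

Let horner_point_poly a x : (point_poly a).[x] = (x == a)%:R.
Proof.
rewrite /point_poly !hornerE.
have [->|ne] := eqVneq x a.
  by rewrite subrr expr0n -subn1 subn_eq0 leqNgt finNzRing_gt1 subr0.
have y0 : x - a != 0 by rewrite subr_eq0.
apply/eqP; rewrite subr_eq0 eq_sym; apply/eqP/(mulfI y0).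
by rewrite mulr1 -exprS prednK // expf_card.
Qed.

Let coef_of f : {ffun expo -> F} :=
  [ffun e : expo => \sum_(a : 'rV[F]_m) f a * \prod_i (point_poly (a 0 i))`_(e i)].

Let coef_ofK : cancel coef_of fun_of.
Proof.
move=> f; apply/ffunP => x; rewrite fun_ofE.
transitivity (\sum_(a : 'rV[F]_m) f a * \prod_i (x 0 i == a 0 i)%:R); last first.
  rewrite (bigD1 x) //= big1 ?mulr1 => [|i _]; last by rewrite eqxx.
  rewrite big1 ?addr0 // => a ne; apply/eqP; rewrite mulf_eq0; apply/orP; right.
  have /existsP[i nei] : [exists i, x 0 i != a 0 i].
    apply: contraNT ne => /existsPn H; apply/eqP/rowP => i.
    by apply/esym/eqP; have := H i; rewrite negbK.
  by rewrite (bigD1 i) //= (negbTE nei) mul0r.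
under eq_bigr => e _ do rewrite ffunE mulr_suml.
rewrite exchange_big; apply: eq_bigr => a _ /=.
under eq_bigr => e _ do rewrite -mulrA -big_split.
rewrite -mulr_sumr; congr (_ * _).
under [RHS]eq_bigr => i _ do
  rewrite -horner_point_poly (horner_coef_wide _ (size_point_poly _)).
by rewrite bigA_distr_bigA.
Qed.

Lemma reduced_repr_exists f : exists p, reduced p && represents p f.
Proof.
exists (poly_of (coef_of f)); rewrite reduced_poly_of; apply/forallP => x.
by apply/eqP; rewrite -[RHS](congr1 (fun g : Bq F m => g x) (coef_ofK f)) ffunE.
Qed.

Let fun_of_inj : injective fun_of.
Proof.
have cardE : (#|{ffun expo -> F}| <= #|Bq F m|)%N.
  by rewrite !card_ffun card_mx mul1n !card_ord.
have bij_coef := inj_card_bij (can_inj coef_ofK) cardE.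
exact: bij_inj (bij_can_bij bij_coef coef_ofK).
Qed.

Let reducedK p : reduced p -> exists c, p = poly_of c.
Proof.
move/allP => rp; exists [ffun e => p@_(mon e)]; apply/mpolyP => d.
have mon_inj : injective mon.
  move=> e e' /mnmP ee; apply/ffunP => i; apply/val_inj.
  by have := ee i; rewrite !mnmE.
rewrite raddf_sum /=.
under eq_bigr => e _ do rewrite mcoeffZ mcoeffX ffunE.
case: (boolP [exists e, mon e == d]) => [/existsP[e /eqP <-]|/existsPn H].
  rewrite (bigD1 e) //= eqxx mulr1 big1 ?addr0 // => e' ne.
  by rewrite (inj_eq mon_inj) (negbTE ne) mulr0.
rewrite big1 => [|e _]; last by rewrite (negbTE (H e)) mulr0.
apply/memN_msupp_eq0/negP => /rp /forallP led.
have ltd i : (d i < q)%N by rewrite -[ltnRHS]prednK // ltnS.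
have /eqP[] := H [ffun i => Ordinal (ltd i)].
by apply/mnmP => i; rewrite mnmE ffunE.
Qed.

Lemma reduced_repr_uniq f p1 p2 :
  reduced p1 -> represents p1 f -> reduced p2 -> represents p2 f -> p1 = p2.
Proof.
move=> /reducedK[c1 ->] /forallP r1 /reducedK[c2 ->] /forallP r2.
congr poly_of; apply: fun_of_inj; apply/ffunP => x.
by rewrite !ffunE (eqP (r1 x)) (eqP (r2 x)).
Qed.

End ReducedForm.

Definition reduced_repr (F : finFieldType) (m : nat) (f : Bq F m) :
  {mpoly F[m]} := xchoose (reduced_repr_exists f).

(* msize p is 1 + the total degree of p and msize 0 = 0, so the zero function *)
(* gets degree 0 here.                                                        *)
Definition deg (F : finFieldType) (m : nat) (f : Bq F m) : nat :=
  (msize (reduced_repr f)).-1.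

Definition weight (F : finFieldType) (m : nat) (f : Bq F m) : nat :=
  #|[set x | f x != 0]|.

Definition RM (F : finFieldType) (r m : nat) : {set Bq F m} :=
  [set f | (deg f <= r)%N].

Lemma RM0 (F : finFieldType) (r m : nat) : 0 \in RM F r m.
Proof.
rewrite inE /deg; suff -> : reduced_repr (0 : Bq F m) = 0 by rewrite msize0.
have /andP[rp pf] := xchooseP (reduced_repr_exists (0 : Bq F m)).
apply: (reduced_repr_uniq rp pf); first by rewrite /reduced msupp0.
by apply/forallP => x; rewrite meval0 ffunE.
Qed.

(* The zero function is only the witness that the code is nonempty (RM0). *)
Definition dist_RM (F : finFieldType) (r m : nat) (f : Bq F m) : nat :=
  weight (f - [arg min_(c < (0 : Bq F m) in RM F r m) weight (f - c)]).

Lemma dist_RM_min (F : finFieldType) (r m : nat) (f : Bq F m) :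
  (exists2 c, c \in RM F r m & dist_RM r f = weight (f - c)) /\
  (forall c, c \in RM F r m -> (dist_RM r f <= weight (f - c)%R)%N).
Proof.
rewrite /dist_RM; case: arg_minnP => [|c cR cmin]; first exact: RM0.
by split=> //; exists c.
Qed.

Definition covering_radius (F : finFieldType) (r m : nat) : nat :=
  \max_(f : Bq F m) dist_RM r f.

(* Main.v *)
Require Import Defs.
From mathcomp Require Import all_boot all_order all_algebra all_field.
From mathcomp Require Import mpoly ring zify.

Set Implicit Arguments.
Unset Strict Implicit.
Unset Printing Implicit Defensive.

Import Order.TTheory GRing.Theory Num.Theory.

Local Open Scope ring_scope.

(** A word at distance [d] from a code word agrees with it on [q ^ m - d]
points, so the claim is about agreements: every function on an [m]-dimensional
space, [m = 2h + 2], agrees with some affine function on at least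
[q ^ (m - 1) + q ^ h] points, and some function never does better.

Every function reaches this bound, by a second moment argument.
For a fixed linear form [l], the agreement counts of [f] with the [q] functions
[l + b] have mean [q ^ (m - 1)].  The sum of the squares of all the counts is the
same for every [f] ([sum_agree_sqr]): two distinct points are both points
of agreement with exactly [q ^ (m - 1)] affine functions.  This gives the
variance [(q - 1) * q ^ (m - 2)] over all affine functions.  On the other hand,
[q] numbers that exceed their mean by at most [D] have their squared
deviations summing to at most [q * (q - 1) * D ^ 2], the extreme case being one
very low value that compensates [q - 1] values equal to the maximum.  Hence
[q ^ (m - 2) <= D ^ 2] ([agree_deviation], [agree_large]).

A function that does not exceed the bound is a nondegenerate quadratic form of
elliptic type, that is, an anisotropic plane plus [h] hyperbolic planes.  (The
sum of [h + 1] hyperbolic planes would agree too much with constants as soon as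
[q > 2].)  For the plane the counts are numbers of points of affine conics
without points at infinity, at most [q + 1] ([card_conic]).  Each
hyperbolic plane adds the product [u * v] of two new coordinates and turns
a bound [C] in dimension [n] into [(q - 1) * q ^ n + q * C]
([hyperbolic_extension]), and [q ^ (n - 1) + q ^ h] into
[q ^ (n + 1) + q ^ (h + 1)]. *)

(** * Affine functions and agreement *)

Definition affine (F : finFieldType) (m : nat) (l : 'cV[F]_m) (b : F) : Bq F m :=
  [ffun x : 'rV[F]_m => (x *m l) 0 0 + b].

Definition agree (F : finFieldType) (m : nat) (f g : Bq F m) : nat :=
  #|[set x | f x == g x]|.

Section Code.
Variables (F : finFieldType) (m : nat).
Implicit Types (f g : Bq F m) (l : 'cV[F]_m) (b : F).

Lemma weight_sub f g : weight (f - g) = (#|F| ^ m - agree f g)%N.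
Proof.
have <- : #|'rV[F]_m| = (#|F| ^ m)%N by rewrite card_mx mul1n.
rewrite /weight cardsCs; congr (_ - _)%N; apply: eq_card => x.
by rewrite !inE !ffunE subr_eq0 negbK.
Qed.

(** The obvious polynomial of degree at most one is reduced because [q > 1], so
uniqueness of the reduced representative identifies it with the one that
defines the degree. *)
Lemma affine_in_RM l b : affine l b \in RM F 1 m.
Proof.
pose p : {mpoly F[m]} := b%:MP + \sum_i l i 0 *: 'X_i.
have supp_p : {subset msupp p <= [pred e | (mdeg e <= 1)%N]}.
  move=> e; rewrite inE => /msuppD_le; rewrite mem_cat => /orP[].
    by rewrite msuppC; case: ifP; rewrite // inE => _ /eqP->; rewrite mdeg0.
  move=> /msupp_sum_le /flatten_mapP[i _ /msuppZ_le].
  by rewrite msuppX inE => /eqP ->; rewrite mdeg1.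
have reduced_p : reduced p.
  apply/allP => e /supp_p; rewrite inE => deg_e; apply/forallP => i.
  have q_gt1 : (1 < #|F|)%N := finNzRing_gt1 F.
  have le_e : (e i <= mdeg e)%N by rewrite mdegE (bigD1 i) //= leq_addr.
  by rewrite (leq_trans le_e) // (leq_trans deg_e) // -ltnS prednK // ltnW.
have repr_p : represents p (affine l b).
  apply/forallP => x; rewrite ffunE mevalD mevalC addrC mxE raddf_sum /=.
  apply/eqP; congr (_ + _); apply: eq_bigr => i _.
  by rewrite mevalZ mevalXU mulrC.
have /andP[red_r repr_r] := xchooseP (reduced_repr_exists (affine l b)).
rewrite inE /deg /reduced_repr (reduced_repr_uniq red_r repr_r reduced_p repr_p).
have : (msize p <= 2)%N.
  by rewrite msizeE big_seq; apply/bigmax_leqP_seq => e /supp_p; rewrite inE.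
by case: (msize p).
Qed.

Lemma RM1_affine f : f \in RM F 1 m -> exists l b, f = affine l b.
Proof.
have /andP[_ /forallP repr_p] := xchooseP (reduced_repr_exists f).
rewrite inE /deg; rewrite -/(reduced_repr f) in repr_p.
set p := reduced_repr f in repr_p * => size_p.
exists (\col_i p@_U_(i)), (p@_0); apply/ffunP => x.
have -> : f x = p.@[x 0] by apply/esym/eqP.
rewrite !ffunE mxE.
have {1}-> : p = (p@_0)%:MP + \sum_i p@_U_(i) *: 'X_i.
  apply/mpolyP => e; rewrite mcoeffD mcoeffC raddf_sum /=.
  under eq_bigr => i _ do rewrite mcoeffZ mcoeffX.
  have [d0|d1|d2] : [\/ mdeg e = 0%N, mdeg e = 1%N | (1 < mdeg e)%N].
    by case: (mdeg e) => [|[|d]]; [apply: Or31|apply: Or32|apply: Or33].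
  - move/eqP: d0; rewrite mdeg_eq0 => /eqP ->.
    rewrite eqxx mulr1 big1 ?addr0 // => i _.
    by rewrite mnm1_eq0 mulr0.
  - have /mdeg1P[j /eqP ->] : mdeg e == 1%N by rewrite d1.
    rewrite mnm1_eq0 mulr0 add0r (bigD1 j) //= eqxx mulr1 big1 ?addr0 //.
    by move=> i ne; rewrite eq_mnm1 (negbTE ne) mulr0.
  rewrite memN_msupp_eq0; last first.
    by apply/negP => /msize_mdeg_lt; lia.
  have -> : (e == 0%MM) = false.
    by apply/negbTE; rewrite -mdeg_eq0; lia.
  rewrite mulr0 add0r big1 // => i _.
  case: eqP => [ei|_]; last by rewrite mulr0.
  by move: d2; rewrite -ei mdeg1.
rewrite mevalD mevalC addrC raddf_sum; congr (_ + _).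
by apply: eq_bigr => i _ /=; rewrite mevalZ mevalXU mxE mulrC.
Qed.

End Code.

(** * Every function agrees often with some affine function *)

Section UpperBound.
Variables (F : finFieldType) (m : nat).
Implicit Types (f : Bq F m) (l : 'cV[F]_m) (b : F).
Local Notation q := #|F|.

Lemma agree_sum f l b :
  agree f (affine l b) = (\sum_x (f x == (x *m l) 0 0 + b)%R)%N.
Proof.
rewrite /agree -sum1_card [RHS]big_mkcond [LHS]big_mkcond /=.
by apply: eq_bigr => x _; rewrite inE ffunE; case: eqP.
Qed.

Lemma sum_agree_const f l : (\sum_b agree f (affine l b) = q ^ m)%N.
Proof.
under eq_bigr => b _ do rewrite agree_sum.
rewrite exchange_big /= -[RHS](_ : #|'rV[F]_m| = _)%N; last by rewrite card_mx mul1n.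
rewrite -sum1_card; apply: eq_bigr => x _.
rewrite (bigD1 (f x - (x *m l) 0 0)) //= addrC subrK eqxx.
rewrite big1 // => b; apply: contraNeq; rewrite eqb0 negbK => /eqP ->.
by apply/eqP; ring.
Qed.

(** Translating by a multiple of a form that takes the value [1] at [v] shows that
the number of linear forms with value [c] at [v] does not depend on [c]. *)
Lemma card_hyperplane (v : 'rV[F]_m) (c : F) :
  v != 0 -> (\sum_(l : 'cV[F]_m) (c == (v *m l) 0 0)%R = q ^ (m - 1))%N.
Proof.
move=> v0; have [i vi] : exists i, v 0 i != 0.
  apply/existsP; apply: contraNT v0 => /existsPn v0.
  by apply/eqP/rowP => i; rewrite mxE; apply/eqP; rewrite -[_ == _]negbK.
pose l0 : 'cV[F]_m := (v 0 i)^-1 *: delta_mx i 0.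
have vl0 : (v *m l0) 0 0 = 1.
  by rewrite -scalemxAr mxE -colE mxE mulVf.
have card_const c' : (\sum_(l : 'cV[F]_m) (c' == (v *m l) 0 0)%R
    = \sum_(l : 'cV[F]_m) (c == (v *m l) 0 0)%R)%N.
  rewrite (reindex_inj (addrI ((c' - c) *: l0))) /=; apply: eq_bigr => l _.
  rewrite mulmxDr -scalemxAr mxE [X in X + _]mxE vl0 mulr1; congr nat_of_bool.
  by rewrite -[LHS]subr_eq0 -[RHS]subr_eq0; congr (_ == 0); ring.
have total : (q * \sum_(l : 'cV[F]_m) (c == (v *m l) 0 0)%R = q ^ m)%N.
  rewrite -sum_nat_const -(eq_bigr _ (fun c' _ => card_const c')) exchange_big /=.
  rewrite -[RHS](_ : #|'cV[F]_m| = _)%N; last by rewrite card_mx muln1.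
  rewrite -sum1_card; apply: eq_bigr => l _.
  rewrite (bigD1 ((v *m l) 0 0)) //= eqxx big1 // => c' /negbTE.
  by move=> ->.
have q_gt0 : (0 < q)%N := ltnW (finNzRing_gt1 F).
have m_gt0 : (0 < m)%N := leq_ltn_trans (leq0n i) (ltn_ord i).
by apply/eqP; rewrite -(eqn_pmul2l q_gt0) total -expnS subn1 prednK.
Qed.

(** A squared count is a number of ordered pairs [(x, y)] of points of agreement.
For given [x] and [y], the value at [x] determines [b] from [l], and
the remaining condition on [l] is its value at [y - x]. *)
Lemma sum_agree_sqr f :
  (\sum_l \sum_b agree f (affine l b) ^ 2
   = q ^ m * (q ^ m + (q ^ m - 1) * q ^ (m - 1)))%N.
Proof.
transitivity (\sum_(x : 'rV[F]_m) \sum_(y : 'rV[F]_m)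
                (if y == x then q ^ m else q ^ (m - 1)))%N; last first.
  have cardV : #|'rV[F]_m| = (q ^ m)%N by rewrite card_mx mul1n.
  rewrite -[X in _ = (X * _)%N]cardV -sum_nat_const; apply: eq_bigr => x _.
  rewrite (bigD1 x) //= eqxx; congr (_ + _)%N.
  rewrite (eq_bigr (fun=> q ^ (m - 1)))%N => [|y /negbTE->] //.
  by rewrite sum_nat_const; congr (_ * _)%N; rewrite -cardV subn1 -(cardC1 x).
under eq_bigr => l _ do under eq_bigr => b _ do
  rewrite agree_sum -mulnn big_distrlr.
transitivity (\sum_(x : 'rV[F]_m) \sum_(y : 'rV[F]_m) \sum_(l : 'cV[F]_m)
   \sum_b (f x == (x *m l) 0 0 + b)%R * (f y == (y *m l) 0 0 + b)%R)%N.
  under eq_bigr => l _ do rewrite exchange_big /=.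
  rewrite exchange_big /=; apply: eq_bigr => x _.
  under eq_bigr => l _ do rewrite exchange_big /=.
  by rewrite exchange_big.
apply: eq_bigr => x _; apply: eq_bigr => y _.
transitivity (\sum_(l : 'cV[F]_m) (f y - f x == ((y - x) *m l) 0 0)%R)%N.
  apply: eq_bigr => l _.
  rewrite (bigD1 (f x - (x *m l) 0 0)) //= addrC subrK eqxx mul1n big1.
    have -> : ((y - x) *m l) 0 0 = (y *m l) 0 0 - (x *m l) 0 0.
      by rewrite mulmxBl !mxE.
    rewrite addn0; congr nat_of_bool.
    rewrite -subr_eq0 -[RHS]subr_eq0; congr (_ == 0); ring.
  move=> b; apply: contraNeq; rewrite muln_eq0 negb_or eqb0 negbK.
  by move=> /andP[/eqP -> _]; apply/eqP; ring.
have [->|ne] := eqVneq y x; last by rewrite card_hyperplane // subr_eq0.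
rewrite !subrr -[RHS](_ : #|'cV[F]_m| = _)%N; last by rewrite card_mx muln1.
by rewrite -sum1_card; apply: eq_bigr => l _; rewrite mul0mx mxE eqxx.
Qed.

Lemma sum_sqr_le (I : finType) (E : I -> nat) :
  (\sum_i E i ^ 2 <= (\sum_i E i) ^ 2)%N.
Proof.
rewrite -mulnn big_distrl; apply: leq_sum => i _ /=.
by rewrite -mulnn leq_mul2l [X in (_ <= X)%N](bigD1 i) //= leq_addr orbT.
Qed.

(** The shortfalls [C - agree f (affine l b)] are nonnegative and, for fixed [l],
their sum over [b] is [q * D], where [D] is the excess of [C] over the mean
[q ^ (m - 1)].  So the sum of their squares is at most [(q * D) ^ 2]; summing
over [l] and expanding the squares with the second moment bounds [D] below. *)
Lemma agree_deviation f (C : nat) : (0 < m)%N ->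
    (forall l b, agree f (affine l b) <= C)%N ->
  (q ^ (m - 1) <= C /\ q ^ (m - 1) <= q * (C - q ^ (m - 1)) ^ 2)%N.
Proof.
move=> m_gt0 leC; have q_gt1 : (1 < #|F|)%N := finNzRing_gt1 F.
have Eqm : (q ^ m = q * q ^ (m - 1))%N by rewrite -expnS subn1 prednK.
have sumE l : (\sum_b (C - agree f (affine l b)) + q ^ m = q * C)%N.
  rewrite -(sum_agree_const f l) -big_split -sum_nat_const.
  by apply: eq_bigr => b _ /=; rewrite subnK.
have geC : (q ^ (m - 1) <= C)%N.
  by rewrite -(leq_pmul2l (ltnW q_gt1)) -Eqm -(sumE 0) leq_addl.
split=> //; set D := (C - q ^ (m - 1))%N.
have sumED l : (\sum_b (C - agree f (affine l b)) = q * D)%N.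
  by rewrite /D mulnBr -(sumE l) -Eqm addnK.
have sumE2 l : (\sum_b (C - agree f (affine l b)) ^ 2 + C * q ^ m * 2
                = q * C ^ 2 + \sum_b agree f (affine l b) ^ 2)%N.
  rewrite -(sum_agree_const f l) big_distrr big_distrl -sum_nat_const.
  rewrite -!big_split; apply: eq_bigr => b _ /=.
  by rewrite -!mulnn; have := leC l b; nia.
have total : (q ^ m * (q * C ^ 2) + q ^ m * (q ^ m + (q ^ m - 1) * q ^ (m - 1))
              <= q ^ m * ((q * D) ^ 2 + C * q ^ m * 2))%N.
  rewrite -(sum_agree_sqr f).
  have sumq n : (q ^ m * n = \sum_(l : 'cV[F]_m) n)%N.
    by rewrite sum_nat_const card_mx muln1.
  rewrite (sumq (q * C ^ 2)%N) (sumq (_ + _)%N) -big_split /=.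
  apply: leq_sum => l _; rewrite -sumE2 leq_add2r -(sumED l); exact: sum_sqr_le.
have qm_gt0 : (0 < q ^ (m - 1))%N by rewrite expn_gt0; lia.
move: total; rewrite -mulnDr leq_pmul2l; last by rewrite expn_gt0; lia.
have -> : C = (q ^ (m - 1) + D)%N by rewrite subnKC.
rewrite Eqm; move: (q ^ (m - 1))%N (D) qm_gt0 => M D' M0; rewrite -!mulnn => H.
(* After substituting C, the moment inequality is q - 1 times the claim. *)
have H2 : ((q - 1) * M <= (q - 1) * (q * (D' * D')))%N.
  by move: H q_gt1; case: (#|F|) => [|[|r]] //; nia.
by move: H2; rewrite leq_pmul2l // subn_gt0.
Qed.

Lemma agree_large f (h : nat) : m = h.*2.+2 ->
  exists l b, (q ^ (m - 1) + q ^ h <= agree f (affine l b))%N.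
Proof.
move=> Em; pose G (lb : 'cV[F]_m * F) := agree f (affine lb.1 lb.2).
have nonempty : (0 < #|{: 'cV[F]_m * F}|)%N by apply/card_gt0P; exists (0, 0).
have [[l b] maxG] := bigop.eq_bigmax G nonempty.
have leG l' b' : (agree f (affine l' b') <= G (l, b))%N.
  by rewrite -maxG; exact: (leq_bigmax (l', b')).
exists l, b; have [] := agree_deviation _ leG; first by rewrite Em.
rewrite -[agree f (affine l b)]/(G (l, b)) => geM; rewrite -leq_subRL //.
have q_gt0 : (0 < q)%N := ltnW (finNzRing_gt1 F).
have -> : (m - 1 = (h * 2).+1)%N by rewrite Em muln2; lia.
by rewrite expnS leq_pmul2l // expnM leq_exp2r.
Qed.

End UpperBound.

(** * An elliptic quadratic form agrees rarely with every affine function *)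

Section LowerBound.
Variable F : finFieldType.
Local Notation q := #|F|.

(** The map [t |-> t ^ 2 - t] sends both [0] and [1] to [0], so it is not onto.
For [c] outside its image the form [x ^ 2 - x * y - c * y ^ 2] is anisotropic;
the cross term makes this work in characteristic [2], where [x ^ 2 - c * y ^ 2]
is always isotropic. *)
Lemma anisotropic_coef : exists c : F, forall t, t ^+ 2 - t != c.
Proof.
have /existsP[c /codomP notin] :
    [exists c, c \notin codom (fun t : F => t ^+ 2 - t)].
  rewrite -negb_forall; apply/negP => /forallP surj.
  have /injectiveP : injectiveb (fun t : F => t ^+ 2 - t).
    rewrite /injectiveb /dinjectiveb; apply/card_uniqP.
    rewrite size_map -cardE; apply/eqP; rewrite -[_ == _]/(_ == #|F|).
    by apply/eqP/eq_card => c; rewrite surj.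
  have E01 : (0 : F) ^+ 2 - 0 = 1 ^+ 2 - 1 by ring.
  by move=> /(_ 0 1 E01) /eqP; rewrite eq_sym oner_eq0.
by exists c => t; apply/eqP => E; apply: notin; exists t.
Qed.

(** Let [Q] be the form on the left and project from a point [(x0, y0)] of the
conic.  A line through it in a given
direction [w] meets the conic again at [(x0, y0) + t w] only if [t * Q w + L w = 0],
with [L] a linear form; as [Q] is anisotropic, this determines [t].  Thus the [q + 1]
directions parametrize all the points; the base point itself comes from a
tangent direction, where [L] vanishes. *)
Lemma card_conic (c : F) : (forall t, t ^+ 2 - t != c) -> forall a b d : F,
  (#|[set z : F * F | (z.1 ^+ 2 - z.1 * z.2 - c * z.2 ^+ 2 == a * z.1 + b * z.2 + d)%R]|
   <= q + 1)%N.
Proof.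
move=> anis a b d; set S := [set z | _].
have [->|[[x0 y0]]] := set_0Vmem S; first by rewrite cards0.
rewrite inE /= => /eqP E0.
pose Q (x y : F) := x ^+ 2 - x * y - c * y ^+ 2.
have Q0 (r : F) : Q r 1 != 0.
  by rewrite /Q mulr1 expr1n mulr1 subr_eq0.
pose L (x y : F) := (2 * x0 - y0 - a) * x - (x0 + 2 * c * y0 + b) * y.
(* [option F] is the projective line: [Some r] is the direction (r, 1), [None]
   is (1, 0), where Q takes the value 1. *)
pose pt (o : option F) : F * F :=
  if o is Some r then (x0 - L r 1 / Q r 1 * r, y0 - L r 1 / Q r 1)
  else (x0 - L 1 0, y0).
suff sub : S \subset [set pt o | o : option F].
  rewrite (leq_trans (subset_leq_card sub)) // (leq_trans (leq_imset_card _ _)) //.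
  by rewrite card_option addn1.
apply/subsetP => -[x y]; rewrite inE /= => /eqP E.
have EQL : Q (x - x0) (y - y0) + L (x - x0) (y - y0) = 0.
  transitivity (x ^+ 2 - x * y - c * y ^+ 2 - (a * x + b * y + d)
    - (x0 ^+ 2 - x0 * y0 - c * y0 ^+ 2 - (a * x0 + b * y0 + d))).
    by rewrite /Q /L; ring.
  by rewrite E E0 !subrr.
have [yy|yy] := eqVneq y y0.
  have [xx|xx] := eqVneq x x0.
    have [L1|L1] := eqVneq (L 1 0) 0.
      by apply/imsetP; exists None; rewrite // /pt L1 subr0 xx yy.
    (* L is not zero at (1, 0), so its kernel is spanned by some (r, 1). *)
    pose r := (x0 + 2 * c * y0 + b) / L 1 0.
    have Lr : L r 1 = 0.
      have -> s : L s 1 = L 1 0 * s - (x0 + 2 * c * y0 + b) by rewrite /L; ring.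
      by rewrite /r mulrC divfK // subrr.
    by apply/imsetP; exists (Some r); rewrite // /pt Lr !mul0r !subr0 xx yy.
  apply/imsetP; exists None; rewrite // /pt yy; congr (_, _).
  have : (x - x0) * (x - x0 + L 1 0) = 0.
    by rewrite -[RHS]EQL yy /Q /L; ring.
  move/eqP; rewrite mulf_eq0 subr_eq0 (negbTE xx) /= => /eqP E1.
  by apply/eqP; rewrite -subr_eq0; apply/eqP; rewrite -[RHS]E1; ring.
have vv : y - y0 != 0 by rewrite subr_eq0.
pose r := (x - x0) / (y - y0).
have Ex : x - x0 = r * (y - y0) by rewrite divfK.
have : (y - y0) * (Q r 1 * (y - y0) + L r 1) = 0.
  by rewrite -[RHS]EQL Ex /Q /L; ring.
move/eqP; rewrite mulf_eq0 (negbTE vv) /= => /eqP E1.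
have Et : y - y0 = - (L r 1 / Q r 1).
  apply/(mulfI (Q0 r)); rewrite mulrN mulrCA mulfV // mulr1.
  by apply/eqP; rewrite -addr_eq0 E1.
apply/imsetP; exists (Some r); rewrite // /pt -mulNr -Et mulrC -Ex.
by congr (_, _); rewrite addrC subrK.
Qed.

Lemma sum_row_mx (n : nat) (G : 'rV[F]_(1 + n) -> nat) :
  (\sum_x G x = \sum_(u : F) \sum_(y : 'rV[F]_n) G (row_mx u%:M y))%N.
Proof.
rewrite pair_big /= (reindex (fun p : F * 'rV[F]_n => row_mx p.1%:M p.2)) //=.
exists (fun x => (lsubmx x 0 0, rsubmx x)) => [[u y] _|x _] /=.
  by rewrite row_mxKl row_mxKr mxE eqxx.
by rewrite -mx11_scalar hsubmxK.
Qed.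

(** Adding the product [u * v] of two new coordinates amounts, for fixed [u] and
[v], to comparing [f] with [l3 + (u * l1 + b + v * (l2 - u))].  If [u] differs
from [l2], this constant takes each value once as [v] varies and the counts add
up to [q ^ n]; if [u = l2], it does not depend on [v] and the counts are [q]
times a single one. *)
Lemma hyperbolic_extension (n C : nat) (f : Bq F n) :
    (forall l b, agree f (affine l b) <= C)%N ->
  exists g : Bq F n.+2,
    forall l b, (agree g (affine l b) <= (q - 1) * q ^ n + q * C)%N.
Proof.
move=> leC.
exists [ffun x : 'rV[F]_(1 + (1 + n)) =>
  lsubmx x 0 0 * lsubmx (rsubmx x) 0 0 + f (rsubmx (rsubmx x))].
move=> l b; pose l1 := usubmx (l : 'cV[F]_(1 + (1 + n))) 0 0.
pose l' := dsubmx (l : 'cV[F]_(1 + (1 + n))).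
pose l2 := usubmx (l' : 'cV[F]_(1 + n)) 0 0.
pose l3 := dsubmx (l' : 'cV[F]_(1 + n)).
have dotE u v (y : 'rV[F]_n) :
    (row_mx u%:M (row_mx v%:M y) *m (l : 'cV[F]_(1 + (1 + n)))) 0 0
    = u * l1 + (v * l2 + (y *m l3) 0 0).
  rewrite -[l](@vsubmxK _ 1 (1 + n)) mul_row_col mul_scalar_mx mxE [X in X + _]mxE.
  rewrite -[dsubmx _](@vsubmxK _ 1 n) mul_row_col mul_scalar_mx.
  by rewrite [X in _ + X]mxE [X in _ + (X + _)]mxE.
rewrite agree_sum (@sum_row_mx (1 + n)).
under eq_bigr => u _ do rewrite sum_row_mx.
apply: (@leq_trans (\sum_(u : F) \sum_(v : F)
    agree f (affine l3 (u * l1 + b + v * (l2 - u))%R))%N).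
  apply/eq_leq/eq_bigr => u _; apply: eq_bigr => v _; rewrite agree_sum.
  apply: eq_bigr => y _; rewrite ffunE !row_mxKr !row_mxKl dotE.
  rewrite !mxE eqxx !mulr1n; congr nat_of_bool.
  by rewrite -[LHS]subr_eq0 -[RHS]subr_eq0; congr (_ == 0); ring.
rewrite (bigD1 l2) //= addnC leq_add //; last first.
  by rewrite -sum_nat_const leq_sum.
rewrite subn1 -(cardC1 l2) -sum_nat_const leq_sum // => u ne.
rewrite -(sum_agree_const f l3).
rewrite [in leqRHS](reindex_inj (addrI (u * l1 + b))) /=.
rewrite [in leqRHS](reindex_inj (mulIf (_ : l2 - u != 0))) //=.
by rewrite subr_eq0 eq_sym.
Qed.

Lemma low_agreement_exists (h : nat) :
  exists f : Bq F h.*2.+2,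
    forall l b, (agree f (affine l b) <= q ^ h.*2.+1 + q ^ h)%N.
Proof.
elim: h => [|h [f leC]].
  have [c anis] := anisotropic_coef.
  exists [ffun x : 'rV[F]_2 =>
    x 0 0 ^+ 2 - x 0 0 * x 0 1 - c * x 0 1 ^+ 2] => l b.
  rewrite expn1 expn0; apply: leq_trans (card_conic anis (l 0 0) (l 1 0) b).
  have inj : injective (fun x : 'rV[F]_2 => (x 0 0, x 0 1)).
    move=> x y [e0 e1]; apply/rowP => -[[|[|//]] lti].
      by move: e0; congr (x 0 _ = y 0 _); apply: val_inj.
    by move: e1; congr (x 0 _ = y 0 _); apply: val_inj.
  rewrite /agree -(card_imset _ inj); apply: subset_leq_card.
  apply/subsetP => _ /imsetP[x Ex ->]; move: Ex; rewrite !inE !ffunE /=.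
  rewrite mxE !big_ord_recl big_ord0 addr0 ![_ * l _ _]mulrC.
  by congr (_ == l _ _ * x _ _ + l _ _ * x _ _ + _); apply: val_inj.
have [g leg] := hyperbolic_extension leC; exists g => l b.
apply: leq_trans (leg l b) _.
have q_gt0 : (0 < q)%N := ltnW (finNzRing_gt1 F).
rewrite mulnDr -!expnS addnA mulnBl mul1n -expnS subnK //.
by rewrite leq_exp2l // ?finNzRing_gt1.
Qed.

End LowerBound.

Local Close Scope ring_scope.

Theorem corollary14 (p k q : nat) (hp : prime p) (hk : 0 < k) (hq : q = p ^ k)
    (F : finFieldType) (hF : #|F| = q)
    (m : nat) (hm : 2 <= m) (hm_even : ~~ odd m) :
  covering_radius F 1 m = (q - 1) * q ^ (m - 1) - q ^ (m %/ 2 - 1).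
Proof.
rewrite -hF; clear p k q hp hk hq hF.
pose h := m./2.-1; have Em : m = h.*2.+2 by rewrite /h; lia.
have -> : m %/ 2 - 1 = h by rewrite divn2 subn1.
have -> : (#|F| - 1) * #|F| ^ (m - 1) - #|F| ^ h
          = #|F| ^ m - (#|F| ^ (m - 1) + #|F| ^ h).
  by rewrite mulnBl mul1n -expnS subn1 prednK ?subnDA //; lia.
apply/eqP; rewrite eqn_leq; apply/andP; split.
  apply/bigmax_leqP => f _; have [_ dist_le] := dist_RM_min 1 f.
  have [l [b le_agree]] := agree_large f Em.
  apply: leq_trans (dist_le _ (affine_in_RM l b)) _.
  by rewrite weight_sub leq_sub2l.
have [f le_agree] : exists f : Bq F m,
    forall l b, agree f (affine l b) <= #|F| ^ (m - 1) + #|F| ^ h.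
  by rewrite Em subn1; exact: low_agreement_exists.
apply: leq_trans (leq_bigmax f).
have [[c /RM1_affine[l [b ->]] ->] _] := dist_RM_min 1 f.
by rewrite weight_sub leq_sub2l.
Qed.
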